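(* Suppose that $q\in[1,2]$, $1\leq a<2$ and $b\in\mathbb{R}$ satisfy $\frac{2+b}{q}=1+a$. Then there exists a constant $C>0$, independent of $u$, such that $$\left(\int_{\mathbb{R}^2}|x|^b|u(x)|^q\,dx\right)^{\frac1q}\leq C\int_{\mathbb{R}^2}|x|^a\,|\mathrm{D}_{\mathrm{sym}}u(x)|\,dx$$ for all $u\in C_c^\infty(\mathbb{R}^2,\mathbb{R}^2)$.
   Context: For a vector field $u=(u_1,u_2)\in C^1(\mathbb{R}^2,\mathbb{R}^2)$, the symmetric derivative (Korn operator) is the matrix field $$\mathrm{D}_{\mathrm{sym}}u=\tfrac12\left(Du+(Du)^T\right)=\begin{bmatrix}\partial_1u_1&\frac{\partial_1u_2+\partial_2u_1}{2}\\ \frac{\partial_2u_1+\partial_1u_2}{2}&\partial_2u_2\end{bmatrix}.$$ $|\cdot|$ denotes the Euclidean norm on vectors and matrices. The constant $C$ may depend on the parameters $q,a,b$. *)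

(* Defs.v *)
From HB Require Import structures.
From mathcomp Require Export all_boot all_order all_algebra.
From mathcomp Require Export all_classical all_reals all_analysis.
Export Order.TTheory GRing.Theory Num.Theory.
Export numFieldNormedType.Exports.

Set Implicit Arguments.
Unset Strict Implicit.
Unset Printing Implicit Defensive.

Local Open Scope classical_set_scope.
Local Open Scope ring_scope.

Section Korn.
Context {R : realType}.

(* The library norm [`|x|] on [R * R] is the sup norm, hence the explicit
   Euclidean norms below. *)

Definition enorm (x : R * R) : R := Num.sqrt (x.1 ^+ 2 + x.2 ^+ 2).

Definition mxenorm (A : 'M[R]_2) : R :=
  Num.sqrt (\sum_(i < 2) \sum_(j < 2) A i j ^+ 2).

Definition coord2 (i : 'I_2) (x : R * R) : R := if i == 0 then x.1 else x.2.

Definition basis2 (j : 'I_2) : R * R := ((j == 0)%:R, (j == 1)%:R).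

Definition partial (j : 'I_2) (f : R * R -> R) : R * R -> R :=
  fun x => 'D_(basis2 j) f x.

Definition iter_partial (s : seq 'I_2) (f : R * R -> R) : R * R -> R :=
  foldr partial f s.

(* [partial] is total, with a junk value where the derivative does not exist,
   so existence of the partial derivatives has to be required explicitly. *)
Definition smooth (f : R * R -> R) : Prop :=
  forall s : seq 'I_2,
    continuous (iter_partial s f) /\
    forall (j : 'I_2) (x : R * R), derivable (iter_partial s f) x (basis2 j).

Definition compactly_supported (u : R * R -> R * R) : Prop :=
  compact (closure [set x | u x != 0]).

Definition Ccinfty (u : R * R -> R * R) : Prop :=
  (forall i : 'I_2, smooth (coord2 i \o u)) /\ compactly_supported u.

Definition Dmx (u : R * R -> R * R) (x : R * R) : 'M[R]_2 :=
  \matrix_(i < 2, j < 2) partial j (coord2 i \o u) x.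

Definition Dsym (u : R * R -> R * R) (x : R * R) : 'M[R]_2 :=
  2^-1 *: (Dmx u x + (Dmx u x)^T).

End Korn.

Notation lebesgue2 := (lebesgue_measure \x lebesgue_measure)%E.

(* Main.v *)
From mathcomp Require Import lra ring measurable_realfun.
Require Import Defs.

(** Why the inequality holds. Let [I] be the integral on the right-hand side.

    Along a line, a weight [W] that does not decrease when moving away from some
    point of the line can be carried through the fundamental theorem of
    calculus: integrating the derivative of a compactly supported [h] from [t]
    outwards gives W(t)|h(t)| <= int W|h'| ([weighted_le_integral]). Restricted
    to any line, the powers |x|^a and |x|^(a-1) are such weights because
    a >= 1; hence no weight is ever differentiated.

    Three directional derivatives are controlled by the symmetric derivative:
    that of u_1 along (1, 0), of u_2 along (0, 1), and of u_1 + u_2 along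
    (1, 1), the last one being the sum of all entries of [Dsym u].

    For q = 1 the first two suffice: the one-dimensional Hardy inequality
    [hardy_line], applied on horizontal lines to u_1 and on vertical lines to
    u_2, gives int |x|^(a-1)|u| <= 2 I ([hardy_Dsym]).

    For q = 2, bound |x|^a |u_1|, |x|^a |u_2| and |x|^a |u_1 + u_2| at a point
    by the integrals of |x|^a |Dsym u| over the lines through it in the three
    directions. The product of two such line integrals with different
    directions has integral I^2 over the plane ([integral_mass_products]),
    and |u|^2 is a combination of products of two different components among
    u_1, u_2 and u_1 + u_2. Hence int (|x|^a |u|)^2 <= 6 I^2
    ([korn_sobolev_Dsym]).

    For 1 < q < 2 the integrand is a weighted geometric mean of those of the two
    endpoint estimates, by the relation between a, b and q
    ([powR_interpolation]). *)

Set Implicit Arguments.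
Unset Strict Implicit.
Unset Printing Implicit Defensive.

Local Open Scope classical_set_scope.
Local Open Scope ring_scope.

(** * Borel measurability in the plane *)

(** The product sigma-algebra is generated by rectangles, so openness has to be
    turned into a countable union: an open set is the union of the rectangles
    with rational endpoints that it contains. *)
Lemma open_measurable2 (R : realType) (U : set (R * R)) :
  open U -> measurable U.
Proof.
move=> oU.
pose box (i : rat * rat * (rat * rat)) : set (R * R) :=
  `]ratr i.1.1, ratr i.1.2[ `*` `]ratr i.2.1, ratr i.2.2[.
pose F i := if `[< box i `<=` U >] then box i else set0.
suff -> : U = \bigcup_i F i.
  apply: countable_bigcupT_measurable => [|i]; first exact: countableP.
  by rewrite /F; case: ifP => // _; exact: measurableX.
apply/seteqP; split => [[x y] Uxy|z [i _]]; last first.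
  by rewrite /F; case: asboolP => // + ?; apply.
have [e /= e0 eU] : exists2 e : R, 0 < e & ball (x, y) e `<=` U.
  by apply/nbhs_ballP; rewrite openE in oU; exact: oU.
have rat_near (t : R) : exists p : rat * rat,
    t - e < ratr p.1 < t /\ t < ratr p.2 < t + e.
  have [|p] := @rat_in_itvoo _ (t - e) t; first by lra.
  have [|r] := @rat_in_itvoo _ t (t + e); first by lra.
  by rewrite !in_itv/= => ? ?; exists (p, r).
have [p [/andP[p1 p2] /andP[p3 p4]]] := rat_near x.
have [r [/andP[r1 r2] /andP[r3 r4]]] := rat_near y.
exists (p, r) => //; rewrite /F; case: asboolP => [_|].
  by split; rewrite /= in_itv/=; apply/andP.
case=> -[a b] [/=]; rewrite !in_itv/= => /andP[a1 a2] /andP[b1 b2].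
by apply: eU; split; rewrite /ball/= ltr_distlC; apply/andP; split; lra.
Qed.

Lemma continuous_measurable_fun2 (R : realType) (f : R * R -> R) :
  continuous f -> measurable_fun setT f.
Proof.
move=> /continuousP cf.
apply: (measurability _ (RGenOpens.measurableE R)).
move=> _ [_ [a [b ->] <-]]; rewrite setTI.
by apply: open_measurable2; apply: cf; exact: interval_open.
Qed.

(** * Translation and reflection invariance on the line *)

Section affine_change_of_variables.
Context {R : realType}.
Local Notation mu := (@lebesgue_measure R).

(** A measure on the line is determined by its values on half-open intervals,
    so checking those suffices to identify the image measure under [phi]. *)
Lemma ge0_integral_isometry (phi : measurableTypeR R -> measurableTypeR R)
    (f : measurableTypeR R -> \bar R) :
  measurable_fun setT phi ->
  (forall a b : R, a < b -> mu (phi @^-1` `]a, b]) = (b - a)%:E) ->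
  measurable_fun setT f -> (forall x, 0 <= f x)%E ->
  (\int[mu]_x f (phi x) = \int[mu]_x f x)%E.
Proof.
move=> mphi phiitv mf f0.
pose nu : {measure set (measurableTypeR R) -> \bar R} :=
  measure_function_pushforward__canonical__measure_function_Measure mu mphi.
rewrite -[LHS](ge0_integral_pushforward mphi mu (D := setT))//.
apply: eq_measure_integral => A mA _; apply/esym.
apply: (@lebesgue_measure_unique R nu) => // X.
move=> /ocitvP[->|[[a b] /= ab ->]]; first by rewrite !measure0.
by rewrite lebesgue_measure_itv/= lte_fin ab /pushforward phiitv.
Qed.

Lemma ge0_integral_translation (c : R) (f : R -> \bar R) :
  measurable_fun setT f -> (forall x, 0 <= f x)%E ->
  (\int[mu]_x f ((x : R) + c)%R = \int[mu]_x f x)%E.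
Proof.
apply: ge0_integral_isometry => [|a b ab]; first exact: measurable_funD.
rewrite [X in mu X](_ : _ = `](a - c), (b - c)]%classic).
  rewrite lebesgue_measure_itv/= lte_fin ltrD2r ab -EFinB.
  by congr EFin; lra.
by apply/seteqP; split => x /=; rewrite !in_itv/= => /andP[? ?];
  apply/andP; split; lra.
Qed.

Lemma ge0_integral_reflection (c : R) (f : R -> \bar R) :
  measurable_fun setT f -> (forall x, 0 <= f x)%E ->
  (\int[mu]_x f (c - (x : R))%R = \int[mu]_x f x)%E.
Proof.
apply: ge0_integral_isometry => [|a b ab]; first exact: measurable_funB.
rewrite [X in mu X](_ : _ = `[(c - b), (c - a)[%classic).
  rewrite lebesgue_measure_itv/= lte_fin ltrD2l ltrN2 ab -EFinB.
  by congr EFin; lra.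
by apply/seteqP; split => x /=; rewrite !in_itv/= => /andP[? ?];
  apply/andP; split; lra.
Qed.

End affine_change_of_variables.

(** * Weighted estimates on a line *)

Section weighted_line.
Context {R : realType}.
Local Notation mu := (@lebesgue_measure R).

(** Going away from the centre [c], one meets [s] before [t]. Treating both
    half-lines at once makes the set of such pairs a single measurable kernel,
    to which Tonelli's theorem applies once. *)
Definition outward (c s t : R) : bool := (c <= s <= t) || (t <= s <= c).

Lemma increment_le_integral (h dh : R -> R) (a b : R) :
  (forall t : R, is_derive t (1 : R) h (dh t)) -> continuous dh -> a <= b ->
  ((`|h b - h a|)%:E <= \int[mu]_(t in `[a, b]) (`|dh t|)%:E)%E.
Proof.
move=> hdh cdh; rewrite le_eqVlt => /orP[/eqP->|ab].
  by rewrite subrr normr0; apply: integral_ge0 => t _; rewrite lee_fin.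
have ch : continuous h.
  move=> t; apply: differentiable_continuous; apply/derivable1_diffP.
  by have [] := hdh t.
have -> : (`|h b - h a|)%:E = `|\int[mu]_(t in `[a, b]) (dh t)%:E|%E.
  rewrite (@continuous_FTC2 _ dh h)//.
  - exact: continuous_subspaceT.
  - split; [by move=> t _; have [] := hdh t| |].
    + exact/cvg_at_right_filter/ch.
    + exact/cvg_at_left_filter/ch.
  - by move=> t _; rewrite derive1E; exact: (@derive_val _ _ _ _ _ _ _ (hdh t)).
apply: (le_trans (le_abse_integral _ _ _)) => //.
apply/measurable_EFinP/measurable_funTS; exact: continuous_measurable_fun.
Qed.

(** The basic estimate. A compactly supported function is recovered at [t] by
    integrating its derivative over the half-line that starts at [t] and points
    away from [c]. On that half-line the weight is at least [W t], so it can be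
    moved under the integral without being differentiated. *)
Lemma weighted_le_integral (h dh W : R -> R) (c M : R) :
  (forall t : R, is_derive t (1 : R) h (dh t)) -> continuous dh ->
  (forall t, M < `|t| -> h t = 0) ->
  (forall t, 0 <= W t) -> measurable_fun setT W ->
  (forall s t, outward c s t -> W s <= W t) -> forall t,
  ((W t * `|h t|)%:E <=
   \int[mu]_r (if outward c t r then W r * `|dh r| else 0)%:E)%E.
Proof.
move=> hdh cdh hM W0 mW Wmono t.
have mdh : measurable_fun setT dh by exact: continuous_measurable_fun.
have m1 : measurable_fun setT (fun r : R => (`|dh r|)%:E).
  exact/measurable_EFinP/measurableT_comp.
have m2 : measurable_fun setT
    (fun r => (if outward c t r then W r * `|dh r| else 0)%:E).
  apply/measurable_EFinP; apply: measurable_fun_ifT => //.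
    by apply: measurable_or; apply: measurable_and;
      exact: measurable_fun_ler.
  by apply: measurable_funM => //; exact: measurableT_comp.
(* The two half-lines differ only in which end of the segment is [t] and at
   which end [h] vanishes. *)
have core a b : a <= b -> `|h t| = `|h b - h a| ->
    (forall r, a <= r <= b -> outward c t r) ->
    ((W t * `|h t|)%:E <=
     \int[mu]_r (if outward c t r then W r * `|dh r| else 0)%:E)%E.
  move=> ab -> out; rewrite EFinM.
  apply: (@le_trans _ _ (\int[mu]_(r in `[a, b])
      (if outward c t r then W r * `|dh r| else 0)%:E)%E); last first.
    apply: ge0_subset_integral => // r _; rewrite lee_fin; case: ifP => // _.
    by rewrite mulr_ge0.
  apply: (@le_trans _ _ ((W t)%:E * \int[mu]_(r in `[a, b]) (`|dh r|)%:E)%E).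
    by rewrite lee_wpmul2l ?lee_fin//; exact: increment_le_integral.
  rewrite -ge0_integralZl_EFin//; last exact: measurable_funTS.
  apply: ge0_le_integral => //.
  - by move=> r _; rewrite -EFinM lee_fin mulr_ge0.
  - apply: measurable_funeM; exact: measurable_funTS.
  - exact: measurable_funTS.
  - move=> r /=; rewrite in_itv/= => /out ctr.
    by rewrite ctr -EFinM lee_fin ler_wpM2r// Wmono.
pose N := `|M| + `|t| + 1.
have hN : h N = 0.
  apply: hM; rewrite /N.
  have := ler_norm M; have := ler_norm (`|M| + `|t| + 1).
  have := normr_ge0 t; lra.
have hNN : h (- N) = 0.
  apply: hM; rewrite normrN /N.
  have := ler_norm M; have := ler_norm (`|M| + `|t| + 1).
  have := normr_ge0 t; lra.
have [tN Nt] : t <= N /\ - N <= t.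
  rewrite /N; have := normr_ge0 M; have := ler_norm t.
  by have := ler_norm (- t); rewrite normrN; lra.
have [ct|tc] := leP c t.
  apply: (core t N) => //; first by rewrite hN sub0r normrN.
  by move=> r /andP[tr _]; rewrite /outward ct tr.
apply: (core (- N) t) => //; first by rewrite hNN subr0.
by move=> r /andP[_ rt]; rewrite /outward rt (ltW tc) orbT.
Qed.

(** Forgetting the half-line makes the bound independent of the position [t] on
    the line, which is what the two-dimensional product argument uses. *)
Lemma weighted_le_total_integral (h dh W e : R -> R) (c M : R) :
  (forall t : R, is_derive t (1 : R) h (dh t)) -> continuous dh ->
  (forall t, M < `|t| -> h t = 0) ->
  (forall t, 0 <= W t) -> measurable_fun setT W ->
  (forall s t, outward c s t -> W s <= W t) ->
  measurable_fun setT e -> (forall t, W t * `|dh t| <= e t) ->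
  forall t, ((W t * `|h t|)%:E <= \int[mu]_r (e r)%:E)%E.
Proof.
move=> hdh cdh hM W0 mW Wmono me dhe t.
apply: (le_trans (weighted_le_integral hdh cdh hM W0 mW Wmono t)).
have mdh : measurable_fun setT dh by exact: continuous_measurable_fun.
have Wdh0 r : 0 <= W r * `|dh r| by rewrite mulr_ge0.
apply: ge0_le_integral => //.
- by move=> r _; rewrite lee_fin; case: ifP.
- apply/measurable_EFinP; apply: measurable_fun_ifT => //.
    by apply: measurable_or; apply: measurable_and;
      exact: measurable_fun_ler.
  by apply: measurable_funM => //; exact: measurableT_comp.
- exact/measurable_EFinP.
- move=> r _; rewrite lee_fin; case: ifP => // _.
  exact: le_trans (Wdh0 r) (dhe r).
Qed.

(** One-dimensional Hardy inequality: integrate the basic estimate over [t] and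
    exchange the integrals. The point [r] is seen from exactly those [t] lying
    between [0] and [r], a segment of length [`|r|]. *)
Lemma hardy_line (h dh W : R -> R) (M : R) :
  (forall t : R, is_derive t (1 : R) h (dh t)) -> continuous dh ->
  (forall t, M < `|t| -> h t = 0) ->
  (forall t, 0 <= W t) -> measurable_fun setT W ->
  (forall s t, outward 0 s t -> W s <= W t) ->
  (\int[mu]_t (W t * `|h t|)%:E <=
   \int[mu]_t (`|t : R| * (W t * `|dh t|))%:E)%E.
Proof.
move=> hdh cdh hM W0 mW Wmono.
have mdh : measurable_fun setT dh by exact: continuous_measurable_fun.
have ch : continuous h.
  move=> t; apply: differentiable_continuous; apply/derivable1_diffP.
  by have [] := hdh t.
have mh : measurable_fun setT h by exact: continuous_measurable_fun.
have mWdh : measurable_fun setT (fun r => W r * `|dh r|).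
  by apply: measurable_funM => //; exact: measurableT_comp.
pose k (z : measurableTypeR R * measurableTypeR R) : \bar R :=
  (if outward 0 z.1 z.2 then W z.2 * `|dh z.2| else 0)%:E.
have k0 z : (0 <= k z)%E.
  by rewrite /k lee_fin; case: ifP => // _; rewrite mulr_ge0.
have mk : measurable_fun setT k.
  apply/measurable_EFinP; apply: measurable_fun_ifT => //=.
    by apply: measurable_or; apply: measurable_and; exact: measurable_fun_ler.
  exact: (measurableT_comp mWdh).
apply: (@le_trans _ _ (\int[mu]_t \int[mu]_r k (t, r))%E).
  apply: ge0_le_integral => //.
  - by move=> t _; rewrite lee_fin mulr_ge0.
  - apply/measurable_EFinP; apply: measurable_funM => //.
    exact: measurableT_comp.
  - exact: (@measurable_fun_fubini_tonelli_F _ _ _ _ _ mu k).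
  - move=> t _; exact: (@weighted_le_integral h dh W 0 M).
rewrite (fubini_tonelli k)//.
apply: ge0_le_integral => //.
- by move=> r _; exact: integral_ge0.
- exact: (@measurable_fun_fubini_tonelli_G _ _ _ _ _ mu k).
- by apply/measurable_EFinP; apply: measurable_funM => //;
    exact: measurableT_comp.
move=> r _.
pose J : interval R := if 0 <= r then `[0, r] else `[r, 0].
have kJ t : k (t, r) = ((W r * `|dh r|)%:E * (\1_[set` J] t)%:E)%E.
  rewrite /k /J/= /outward indicE.
  have [r0|r0] := leP 0 r; rewrite mem_setE in_itv/=.
    case: (boolP (0 <= t <= r)) => [_|tr]/=; first by rewrite mule1.
    rewrite mule0; case: ifP => // /andP[rt t0].
    by exfalso; move: tr; rewrite negb_and; lra.
  case: (boolP (r <= t <= 0)) => [_|tr]/=; first by rewrite orbT mule1.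
  rewrite mule0 orbF; case: ifP => // /andP[rt t0].
  by exfalso; move: tr; rewrite negb_and; lra.
under eq_integral do rewrite kJ.
have mJ : measurable [set` J] by rewrite /J; case: ifP.
rewrite ge0_integralZl_EFin//; last 2 first.
  by apply/measurable_EFinP; exact: measurable_indic.
  by rewrite mulr_ge0.
have muJ : (mu [set` J] <= `|r : R|%:E)%E.
  rewrite lebesgue_measure_itv /J; have [r0|r0] := leP 0 r.
    by rewrite /=; case: ifP => // _; rewrite -?EFinB lee_fin ?subr0 ler_norm.
  by rewrite /= lte_fin r0 -?EFinB lee_fin sub0r -normrN ler_norm.
rewrite integral_indic// setIT [in leRHS]mulrC.
by rewrite [leRHS]EFinM lee_wpmul2l ?lee_fin ?mulr_ge0.
Qed.

End weighted_line.

(** * Derivatives along horizontal, vertical and diagonal lines *)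

Section derivatives_along_lines.
Context {R : realType}.
Variable F : R * R -> R.
Hypothesis dF : forall j x, derivable F x (basis2 j).

Lemma is_derive_horizontal (s t : R) :
  is_derive t (1 : R) (fun t => F (t, s)) (partial 0 F (t, s)).
Proof.
have E : (fun h : R => h^-1 *: (((fun t => F (t, s)) \o shift t) (h *: 1) -
      F (t, s))) =
    (fun h : R => h^-1 *: ((F \o shift (t, s)) (h *: basis2 0) - F (t, s))).
  apply/funext => h /=; congr (_ *: (F _ - _)).
  by apply: injective_projections; rewrite //= scaler0 add0r.
apply: DeriveDef; first by rewrite /derivable E; exact: dF.
by rewrite /derive E.
Qed.

Lemma is_derive_vertical (s t : R) :
  is_derive t (1 : R) (fun t => F (s, t)) (partial 1 F (s, t)).
Proof.
have E : (fun h : R => h^-1 *: (((fun t => F (s, t)) \o shift t) (h *: 1) -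
      F (s, t))) =
    (fun h : R => h^-1 *: ((F \o shift (s, t)) (h *: basis2 1) - F (s, t))).
  apply/funext => h /=; congr (_ *: (F _ - _)).
  by apply: injective_projections; rewrite //= scaler0 add0r.
apply: DeriveDef; first by rewrite /derivable E; exact: dF.
by rewrite /derive E.
Qed.

Lemma mean_value_signed (g dg : R -> R) (x k : R) :
  (forall t : R, is_derive t (1 : R) g (dg t)) ->
  exists2 c, `|c - x| <= `|k| & g (k + x) - g x = dg c * k.
Proof.
move=> hg.
have cg : continuous g.
  move=> t; apply: differentiable_continuous; apply/derivable1_diffP.
  by case: (hg t).
have [k0|k0] := leP 0 k.
  have [||c] := @MVT_segment _ g dg x (k + x).
  - by lra.
  - exact: continuous_subspaceT.
  rewrite in_itv/= => /andP[xc cx] ->; exists c; last by congr (_ * _); lra.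
  by rewrite (ger0_norm k0) ger0_norm; lra.
have [||c] := @MVT_segment _ g dg (k + x) x.
- by lra.
- exact: continuous_subspaceT.
rewrite in_itv/= => /andP[xc cx] E; exists c.
  by rewrite (ltr0_norm k0) ler0_norm; lra.
by rewrite -opprB E; lra.
Qed.

(** Chain rule in the direction (1, 1) from partial derivatives only: a
    diagonal step is a vertical step followed by a horizontal one. The vertical
    quotient [Q2] starts at the base point, but the horizontal one [Q1] starts
    at the moving end of the vertical step, hence the mean value theorem and
    the continuity of the horizontal derivative. *)
Lemma is_derive_diagonal (s t : R) : continuous (partial 0 F) ->
  is_derive t (1 : R) (fun t => F (s + t, t))
    (partial 0 F (s + t, t) + partial 1 F (s + t, t)).
Proof.
move=> cF.
pose Q1 k : R := k^-1 *: (F (k + (s + t), k + t) - F (s + t, k + t)).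
pose Q2 k : R := k^-1 *: (((fun r => F (s + t, r)) \o shift t) (k *: (1 : R)) -
  F (s + t, t)).
have cQ2 : Q2 k @[k --> 0^'] --> partial 1 F (s + t, t).
  have [dv <-] := is_derive_vertical (s + t) t.
  exact: dv.
have cQ1 : Q1 k @[k --> 0^'] --> partial 0 F (s + t, t).
  apply/cvgrPdist_le => /= e e0.
  have /cvgrPdist_le/(_ e e0)/nbhs_ballP[d /= d0 dP] := cF (s + t, t).
  near=> k.
  have k0 : k != 0 by near: k; exact: nbhs_dnbhs_neq.
  have kd : `|k| < d by near: k; exact: dnbhs0_lt.
  have [c ck E] := mean_value_signed (s + t) k (is_derive_horizontal (k + t)).
  rewrite /Q1 E /GRing.scale/= mulrC mulfK//.
  apply: dP; split; rewrite /ball/=.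
    by rewrite distrC (le_lt_trans ck).
  by rewrite opprD addrCA subrr addr0 normrN.
have E : (fun k : R => k^-1 *: (((fun t => F (s + t, t)) \o shift t) (k *: 1) -
      F (s + t, t))) = Q1 \+ Q2.
  apply/funext => k /=; rewrite /Q1 /Q2/= -scalerDr; congr (_ *: _).
  by rewrite [k *: 1]mulr1 (addrCA k s t) [RHS]addrA subrK.
have cQ : (fun k : R => k^-1 *: (((fun t => F (s + t, t)) \o shift t) (k *: 1) -
      F (s + t, t))) @ 0^' --> partial 0 F (s + t, t) + partial 1 F (s + t, t).
  by rewrite E; apply: cvgD; [exact: cQ1|exact: cQ2].
apply: DeriveDef; first by apply/cvg_ex; eexists; exact: cQ.
exact/cvg_lim.
Unshelve. all: by end_near. Qed.

End derivatives_along_lines.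

(** * Pointwise bounds for the symmetric derivative and the weights *)

Section pointwise_bounds.
Context {R : realType}.

Lemma norm_entry_le_mxenorm (A : 'M[R]_2) i j : `|A i j| <= mxenorm A.
Proof.
rewrite -sqrtr_sqr; apply: ler_wsqrtr.
rewrite (bigD1 i)//= (bigD1 j)//= -addrA lerDl.
by rewrite addr_ge0// sumr_ge0// => k _; [|rewrite sumr_ge0// => l _];
  exact: sqr_ge0.
Qed.

Let norm_sum4_le (p q r s : R) : `|p + q + (r + s)| <=
  2 * Num.sqrt (p ^+ 2 + q ^+ 2 + (r ^+ 2 + s ^+ 2)).
Proof.
have -> : 2 = Num.sqrt (2 ^+ 2) :> R by rewrite sqrtr_sqr ger0_norm.
rewrite -sqrtrM ?sqr_ge0// -sqrtr_sqr; apply: ler_wsqrtr.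
rewrite -subr_ge0 [leRHS](_ : _ = (p - q) ^+ 2 + (p - r) ^+ 2 + (p - s) ^+ 2 +
  (q - r) ^+ 2 + (q - s) ^+ 2 + (r - s) ^+ 2); last by ring.
by rewrite !addr_ge0// sqr_ge0.
Qed.

Lemma norm_sum_le_mxenorm (A : 'M[R]_2) :
  `|A 0 0 + A 0 1 + (A 1 0 + A 1 1)| <= 2 * mxenorm A.
Proof.
apply: le_trans (norm_sum4_le _ _ _ _) _.
rewrite /mxenorm !big_ord_recl !big_ord0 !addr0.
by rewrite (_ : lift ord0 ord0 = 1)//; exact: val_inj.
Qed.

Lemma Dsym_pure_bound (u : R * R -> R * R) (x : R * R) i :
  `|partial i (coord2 i \o u) x| <= mxenorm (Dsym u x).
Proof.
apply: le_trans (norm_entry_le_mxenorm _ i i).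
rewrite !mxE; move: (partial i _ x) => p.
by rewrite (_ : 2^-1 * (p + p) = p)//; lra.
Qed.

(** The derivative of [u_1 + u_2] in the direction (1, 1) is the sum of all the
    entries of the symmetric derivative: this is where the off-diagonal entry,
    the only one that mixes components and variables, is used. *)
Lemma Dsym_diagonal_bound (u : R * R -> R * R) (x : R * R) :
  `|partial 0 (coord2 0 \o u) x + partial 1 (coord2 0 \o u) x +
    (partial 0 (coord2 1 \o u) x + partial 1 (coord2 1 \o u) x)| <=
  2 * mxenorm (Dsym u x).
Proof.
apply: le_trans (norm_sum_le_mxenorm _); rewrite !mxE.
move: (partial 0 (coord2 0 \o u) x) (partial 1 (coord2 0 \o u) x) => p q.
move: (partial 0 (coord2 1 \o u) x) (partial 1 (coord2 1 \o u) x) => r s.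
by rewrite [X in _ <= `|X|](_ : _ = p + q + (r + s))//; lra.
Qed.

Lemma enorm_ge0 (x : R * R) : 0 <= enorm x.
Proof. exact: sqrtr_ge0. Qed.

Lemma enorm_sqr (x : R * R) : enorm x ^+ 2 = x.1 ^+ 2 + x.2 ^+ 2.
Proof. by rewrite sqr_sqrtr// addr_ge0 ?sqr_ge0. Qed.

Lemma enorm_le_sum (x : R * R) : enorm x <= `|x.1| + `|x.2|.
Proof.
rewrite -(@ler_pXn2r _ 2) ?nnegrE ?enorm_ge0 ?addr_ge0//.
rewrite enorm_sqr sqrrD !real_normK ?num_real// -addrA lerD2l lerDr.
by rewrite mulrn_wge0 ?mulr_ge0.
Qed.

Lemma le_enorm_powR (p : R) (x y : R * R) : 0 <= p ->
  x.1 ^+ 2 + x.2 ^+ 2 <= y.1 ^+ 2 + y.2 ^+ 2 -> enorm x `^ p <= enorm y `^ p.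
Proof.
move=> p0 xy; apply: ge0_ler_powR; rewrite ?nnegrE ?enorm_ge0//.
exact: ler_wsqrtr.
Qed.

Lemma outward_sqr (c s t : R) : outward c s t -> (s - c) ^+ 2 <= (t - c) ^+ 2.
Proof. by rewrite !expr2 => /orP[] /andP[? ?]; nra. Qed.

Lemma enorm_powR_horizontal (p y s t : R) : 0 <= p -> outward 0 s t ->
  enorm (s, y) `^ p <= enorm (t, y) `^ p.
Proof.
move=> p0 /outward_sqr; rewrite !subr0 => st.
by apply: le_enorm_powR => //=; rewrite lerD2r.
Qed.

Lemma enorm_powR_vertical (p x s t : R) : 0 <= p -> outward 0 s t ->
  enorm (x, s) `^ p <= enorm (x, t) `^ p.
Proof.
move=> p0 /outward_sqr; rewrite !subr0 => st.
by apply: le_enorm_powR => //=; rewrite lerD2l.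
Qed.

(** On the line [t |-> (d + t, t)] the point closest to the origin is at
    [t = - (d / 2)], and the squared norm is a parabola around it. *)
Lemma enorm_powR_diagonal (p d s t : R) : 0 <= p -> outward (- (d / 2)) s t ->
  enorm (d + s, s) `^ p <= enorm (d + t, t) `^ p.
Proof.
move=> p0 /outward_sqr st.
by apply: le_enorm_powR => //=; move: st; rewrite !expr2; lra.
Qed.

Lemma measurable_sqrt : measurable_fun setT (@Num.sqrt R).
Proof. by apply: continuous_measurable_fun; exact: sqrt_continuous. Qed.

Lemma measurable_enorm : measurable_fun setT (@enorm R).
Proof.
apply: (measurableT_comp measurable_sqrt).
apply: measurable_funD; apply: measurable_funX; [exact: measurable_fst|].
exact: measurable_snd.
Qed.

End pointwise_bounds.

(** * Integrals over the lines of three directions *)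

Section line_integrals.
Context {R : realType}.
Local Notation mu := (@lebesgue_measure R).
Local Notation T := (measurableTypeR R).
Local Open Scope ereal_scope.

Variable e : T * T -> \bar R.
Hypothesis me : measurable_fun setT e.
Hypothesis e0 : forall z, 0 <= e z.

(** The three masses integrate [e] over the line through a given point in the
    directions (1, 0), (0, 1) and (1, 1). The diagonal line through [(x, y)] is
    labelled by [x - y]. *)
Definition horizontal_mass (y : T) := \int[mu]_t e (t, y).
Definition vertical_mass (x : T) := \int[mu]_t e (x, t).
Definition diagonal_mass (s : T) := \int[mu]_t e ((s : R) + (t : R), t)%R.

Let mass := \int[lebesgue2]_z e z.

Let me_shear : measurable_fun setT
  (fun z : T * T => e ((z.1 : R) + (z.2 : R), z.2)%R).
Proof.
apply: measurableT_comp => //; apply: measurable_fun_pair => //.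
exact: measurable_funD.
Qed.

Lemma horizontal_mass_ge0 y : 0 <= horizontal_mass y.
Proof. exact: integral_ge0. Qed.

Lemma vertical_mass_ge0 x : 0 <= vertical_mass x.
Proof. exact: integral_ge0. Qed.

Lemma diagonal_mass_ge0 s : 0 <= diagonal_mass s.
Proof. exact: integral_ge0. Qed.

Lemma measurable_horizontal_mass : measurable_fun setT horizontal_mass.
Proof. exact: (@measurable_fun_fubini_tonelli_G _ _ _ _ _ mu e). Qed.

Lemma measurable_vertical_mass : measurable_fun setT vertical_mass.
Proof. exact: (@measurable_fun_fubini_tonelli_F _ _ _ _ _ mu e). Qed.

Lemma measurable_diagonal_mass : measurable_fun setT diagonal_mass.
Proof.
exact: (@measurable_fun_fubini_tonelli_F _ _ _ _ _ mu
  (fun z : T * T => e ((z.1 : R) + (z.2 : R), z.2)%R)).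
Qed.

Lemma integral_horizontal_mass : \int[mu]_y horizontal_mass y = mass.
Proof. by rewrite /mass fubini_tonelli2. Qed.

Lemma integral_vertical_mass : \int[mu]_x vertical_mass x = mass.
Proof. by rewrite /mass fubini_tonelli1. Qed.

(** The shear [(s, t) |-> (s + t, t)] preserves area: after exchanging the
    integrals it is a translation in the inner variable. *)
Lemma integral_diagonal_mass : \int[mu]_s diagonal_mass s = mass.
Proof.
rewrite (fubini_tonelli
  (fun z : T * T => e ((z.1 : R) + (z.2 : R), z.2)%R))//.
rewrite -integral_horizontal_mass; apply: eq_integral => t _.
rewrite (@ge0_integral_translation _ t (fun r => e (r, t)))//.
exact: measurableT_comp.
Qed.

(** Products of masses for two different directions. They behave like products
    of functions of independent variables, which fails for equal directions. *)
Definition mass_products (z : T * T) :=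
  horizontal_mass z.2 * diagonal_mass ((z.1 : R) - z.2)%R +
  vertical_mass z.1 * diagonal_mass ((z.1 : R) - z.2)%R +
  vertical_mass z.1 * horizontal_mass z.2.

Let h0 := horizontal_mass_ge0.
Let v0 := vertical_mass_ge0.
Let d0 := diagonal_mass_ge0.
Let mh := measurable_horizontal_mass.
Let mv := measurable_vertical_mass.
Let md := measurable_diagonal_mass.

Let mdB : measurable_fun setT
  (fun z : T * T => diagonal_mass ((z.1 : R) - z.2)%R).
Proof. by apply: measurableT_comp => //; exact: measurable_funB. Qed.

Let mh2 : measurable_fun setT (fun z : T * T => horizontal_mass z.2).
Proof. exact: measurableT_comp. Qed.

Let mv1 : measurable_fun setT (fun z : T * T => vertical_mass z.1).
Proof. exact: measurableT_comp. Qed.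

Lemma mass_products_ge0 z : 0 <= mass_products z.
Proof. by rewrite !adde_ge0// mule_ge0. Qed.

Lemma measurable_mass_products : measurable_fun setT mass_products.
Proof.
by apply: emeasurable_funD; [apply: emeasurable_funD|];
  exact: emeasurable_funM.
Qed.

(** In each product the first factor depends on one coordinate only, and for
    fixed value of that coordinate the second factor is, up to a translation or
    a reflection, a function of the other one. So each of the three integrals
    factorises into the square of the total mass. *)
Lemma integral_mass_products :
  \int[lebesgue2]_z mass_products z = 3%:E * (mass * mass).
Proof.
have mass0 : 0 <= mass by exact: integral_ge0.
rewrite ge0_integralD//; last 4 first.
  by move=> z _; rewrite adde_ge0// mule_ge0.
  by apply: emeasurable_funD; exact: emeasurable_funM.
  by move=> z _; rewrite mule_ge0.
  exact: emeasurable_funM.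
rewrite ge0_integralD//; last 4 first.
  by move=> z _; rewrite mule_ge0.
  exact: emeasurable_funM.
  by move=> z _; rewrite mule_ge0.
  exact: emeasurable_funM.
have -> : \int[lebesgue2]_z
    (horizontal_mass z.2 * diagonal_mass ((z.1 : R) - z.2)%R) = mass * mass.
  rewrite fubini_tonelli2/=; last 2 first.
    exact: emeasurable_funM.
    by move=> z; rewrite mule_ge0.
  rewrite /fubini_G/= -{1}integral_horizontal_mass -ge0_integralZr//.
  apply: eq_integral => y _; rewrite ge0_integralZl//; last first.
    by apply: measurableT_comp => //; exact: measurable_funB.
  congr (_ * _); rewrite -integral_diagonal_mass.
  exact: (@ge0_integral_translation _ (- (y : R))%R diagonal_mass).
have -> : \int[lebesgue2]_z
    (vertical_mass z.1 * diagonal_mass ((z.1 : R) - z.2)%R) = mass * mass.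
  rewrite fubini_tonelli1/=; last 2 first.
    exact: emeasurable_funM.
    by move=> z; rewrite mule_ge0.
  rewrite /fubini_F/= -{1}integral_vertical_mass -ge0_integralZr//.
  apply: eq_integral => x _; rewrite ge0_integralZl//; last first.
    by apply: measurableT_comp => //; exact: measurable_funB.
  congr (_ * _); rewrite -integral_diagonal_mass.
  exact: (@ge0_integral_reflection _ x diagonal_mass).
have -> : \int[lebesgue2]_z
    (vertical_mass z.1 * horizontal_mass z.2) = mass * mass.
  rewrite fubini_tonelli1/=; last 2 first.
    exact: emeasurable_funM.
    by move=> z; rewrite mule_ge0.
  rewrite /fubini_F/= -{1}integral_vertical_mass -ge0_integralZr//.
  apply: eq_integral => x _; rewrite ge0_integralZl//.
  by congr (_ * _); rewrite -integral_horizontal_mass.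
have mm0 : 0 <= mass * mass by exact: mule_ge0.
rewrite -[X in X + _ + _]mul1e -[X in _ + X + _]mul1e -[X in _ + _ + X]mul1e.
rewrite -!ge0_muleDl ?lee_fin// ?adde_ge0//.
by congr (_ * _); rewrite -!EFinD; congr EFin; lra.
Qed.

End line_integrals.

(** * Interpolation between the endpoint exponents *)

Section interpolation.
Context {R : realType}.

(** The left-hand side is [l `^ q] times a weighted geometric mean, with weights
    [2 - q] and [q - 1], of the two summands on the right; a weighted geometric
    mean is at most the maximum, hence at most the sum. The relation between
    [a], [b] and [q] makes the powers of [r] match. *)
Lemma powR_interpolation (q a b l r v : R) :
  1 <= q -> q <= 2 -> 1 <= a -> (2 + b) / q = 1 + a ->
  0 < l -> 0 <= r -> 0 <= v ->
  r `^ b * v `^ q <=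
  l `^ q * (l^-1 * (r `^ (a - 1) * v) + l^-1 ^+ 2 * (r `^ a * v) ^+ 2).
Proof.
move=> q1 q2 a1 qab l0 r0 v0.
have bE : b = q * (1 + a) - 2.
  by rewrite -qab mulrC divfK; lra.
have rhs0 : 0 <= l `^ q *
    (l^-1 * (r `^ (a - 1) * v) + l^-1 ^+ 2 * (r `^ a * v) ^+ 2).
  have li0 : 0 <= l^-1 by rewrite invr_ge0 ltW.
  by rewrite mulr_ge0 ?powR_ge0// addr_ge0// ?mulr_ge0 ?powR_ge0 ?sqr_ge0.
move: v0; rewrite le_eqVlt => /orP[/eqP v0|v0].
  by rewrite -[X in _ * X `^ q]v0 powR0 ?mulr0//; lra.
move: r0; rewrite le_eqVlt => /orP[/eqP r0|r0].
  have [b0|b0] := eqVneq b 0; last by rewrite -[X in X `^ b]r0 powR0// mul0r.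
  (* [0 `^ 0 = 1], so the value at the origin counts when [b = 0]; this forces
     [q = a = 1], where the first summand equals the left-hand side. *)
  have q1' : q = 1 by nra.
  have a1' : a = 1 by nra.
  rewrite b0 q1' a1' subrr !powRr0 !powRr1 ?(ltW l0) ?(ltW v0)//; last first.
    by rewrite -r0.
  rewrite mulrDr mulrA divff ?gt_eqF// !mul1r lerDl.
  by rewrite mulr_ge0 ?(ltW l0)// mulr_ge0 ?sqr_ge0.
(* In logarithmic coordinates the geometric mean is a convex combination. *)
have [[x ->] [y ->] [z ->]] : [/\ exists x, r = expR x, exists y, v = expR y
    & exists z, l = expR z].
  by split; eexists; apply/esym/lnK.
rewrite -!expRM -!expRN -!expRD -!expRM_natl -!expRD.
set X := _ + _; set Y := - z + _; set Z := 2 * - z + _.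
have XE : X = z * q + ((2 - q) * Y + (q - 1) * Z).
  rewrite /X /Y /Z bE; ring.
rewrite XE expRD ler_pM2l ?expR_gt0//.
have [YZ|ZY] := leP Y Z.
  apply: (@le_trans _ _ (expR Z)); first by rewrite ler_expR; nra.
  by rewrite lerDr expR_ge0.
apply: (@le_trans _ _ (expR Y)); first by rewrite ler_expR; nra.
by rewrite lerDl expR_ge0.
Qed.

End interpolation.

(** * Hardy inequalities in the plane *)

Section plane_estimates.
Context {R : realType}.
Local Notation mu := (@lebesgue_measure R).
Local Notation T := (measurableTypeR R).

Lemma continuous_along (f : R * R -> R) (p q : R -> R) :
  continuous f -> continuous p -> continuous q ->
  continuous (fun t => f (p t, q t)).
Proof.
move=> cf cp cq t; apply: (@continuous_comp _ _ _ (fun t => (p t, q t)) f).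
  exact: (cvg_pair (cp t) (cq t)).
exact: cf.
Qed.

Lemma measurable_enorm_powR (p : R) :
  measurable_fun setT (fun z : T * T => enorm z `^ p).
Proof. exact: (measurableT_comp (measurable_powR p) measurable_enorm). Qed.

Lemma measurable_weighted (p : R) (f : R * R -> R) : continuous f ->
  measurable_fun setT (fun z : T * T => (enorm z `^ p * `|f z|)%:E).
Proof.
move=> cf; apply/measurable_EFinP; apply: measurable_funM.
  exact: measurable_enorm_powR.
apply: measurableT_comp => //. exact: continuous_measurable_fun2.
Qed.

Lemma norm_fst_le_enorm (x : R * R) : `|x.1| <= enorm x.
Proof. by rewrite -sqrtr_sqr; apply: ler_wsqrtr; rewrite lerDl sqr_ge0. Qed.

Lemma norm_snd_le_enorm (x : R * R) : `|x.2| <= enorm x.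
Proof. by rewrite -sqrtr_sqr; apply: ler_wsqrtr; rewrite lerDr sqr_ge0. Qed.

Variables (U : R * R -> R) (M : R).
Hypothesis dU : forall j x, derivable U x (basis2 j).
Hypothesis cU : continuous U.
Hypothesis cdU : forall j, continuous (partial j U).
Hypothesis UM : forall x, (M < `|x.1|) || (M < `|x.2|) -> U x = 0.

(** On each horizontal line [enorm `^ (a - 1)] increases away from the vertical
    axis because [1 <= a], so the one-dimensional Hardy inequality applies; the
    factor [`|z.1|] that it produces is at most [enorm z]. *)
Lemma hardy_horizontal (a : R) : 1 <= a ->
  (\int[lebesgue2]_z (enorm z `^ (a - 1) * `|U z|)%:E <=
   \int[lebesgue2]_z (enorm z `^ a * `|partial 0 U z|)%:E)%E.
Proof.
move=> a1.
have m1 := measurable_weighted (a - 1) cU.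
have m2 := measurable_weighted a (@cdU 0).
have n1 (z : T * T) : (0 <= (enorm z `^ (a - 1) * `|U z|)%:E)%E.
  by rewrite lee_fin mulr_ge0 ?powR_ge0.
have n2 (z : T * T) : (0 <= (enorm z `^ a * `|partial 0 U z|)%:E)%E.
  by rewrite lee_fin mulr_ge0 ?powR_ge0.
rewrite fubini_tonelli2// fubini_tonelli2//.
apply: ge0_le_integral => //.
- by move=> y _; exact: integral_ge0.
- exact: (@measurable_fun_fubini_tonelli_G _ _ _ _ _ mu).
- exact: (@measurable_fun_fubini_tonelli_G _ _ _ _ _ mu).
move=> y _.
have cx : continuous (fun t : R => partial 0 U (t, y)).
  by apply: continuous_along => // t; [exact: cvg_id|exact: cvg_cst].
have mx : measurable_fun setT (fun t : R => enorm (t, y : R) `^ (a - 1)).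
  apply: (measurableT_comp (measurable_enorm_powR (a - 1))).
  exact: pair2_measurable.
apply: le_trans (@hardy_line _ (fun t => U (t, y)) _
    (fun t => enorm (t, y : R) `^ (a - 1)) M
  (is_derive_horizontal dU y) cx _ _ mx _) _.
- by move=> t Mt; apply: UM; rewrite Mt.
- by move=> t; exact: powR_ge0.
- by move=> s t; apply: enorm_powR_horizontal; lra.
apply: ge0_le_integral => //.
- by move=> t _; rewrite lee_fin !mulr_ge0 ?powR_ge0.
- apply/measurable_EFinP; apply: measurable_funM; first exact: normr_measurable.
  apply: measurable_funM => //; apply: measurableT_comp => //.
  exact: continuous_measurable_fun.
- apply: (measurableT_comp m2); exact: pair2_measurable.
move=> t _; rewrite lee_fin/= mulrA ler_wpM2r//.
rewrite -(@mulr_powRB1 _ (enorm (t, y)) a) ?enorm_ge0//; last lra.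
by rewrite ler_wpM2r ?powR_ge0//; exact: (norm_fst_le_enorm (t, y)).
Qed.

Lemma hardy_vertical (a : R) : 1 <= a ->
  (\int[lebesgue2]_z (enorm z `^ (a - 1) * `|U z|)%:E <=
   \int[lebesgue2]_z (enorm z `^ a * `|partial 1 U z|)%:E)%E.
Proof.
move=> a1.
have m1 := measurable_weighted (a - 1) cU.
have m2 := measurable_weighted a (@cdU 1).
have n1 (z : T * T) : (0 <= (enorm z `^ (a - 1) * `|U z|)%:E)%E.
  by rewrite lee_fin mulr_ge0 ?powR_ge0.
have n2 (z : T * T) : (0 <= (enorm z `^ a * `|partial 1 U z|)%:E)%E.
  by rewrite lee_fin mulr_ge0 ?powR_ge0.
rewrite fubini_tonelli1// fubini_tonelli1//.
apply: ge0_le_integral => //.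
- by move=> x _; exact: integral_ge0.
- exact: (@measurable_fun_fubini_tonelli_F _ _ _ _ _ mu).
- exact: (@measurable_fun_fubini_tonelli_F _ _ _ _ _ mu).
move=> x _.
have cy : continuous (fun t : R => partial 1 U (x, t)).
  by apply: continuous_along => // t; [exact: cvg_cst|exact: cvg_id].
have my : measurable_fun setT (fun t : R => enorm (x : R, t) `^ (a - 1)).
  apply: (measurableT_comp (measurable_enorm_powR (a - 1))).
  exact: pair1_measurable.
apply: le_trans (@hardy_line _ (fun t => U (x, t)) _
    (fun t => enorm (x : R, t) `^ (a - 1)) M
  (is_derive_vertical dU x) cy _ _ my _) _.
- by move=> t Mt; apply: UM; rewrite Mt orbT.
- by move=> t; exact: powR_ge0.
- by move=> s t; apply: enorm_powR_vertical; lra.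
apply: ge0_le_integral => //.
- by move=> t _; rewrite lee_fin !mulr_ge0 ?powR_ge0.
- apply/measurable_EFinP; apply: measurable_funM; first exact: normr_measurable.
  apply: measurable_funM => //; apply: measurableT_comp => //.
  exact: continuous_measurable_fun.
- apply: (measurableT_comp m2); exact: pair1_measurable.
move=> t _; rewrite lee_fin/= mulrA ler_wpM2r//.
rewrite -(@mulr_powRB1 _ (enorm (x, t)) a) ?enorm_ge0//; last lra.
by rewrite ler_wpM2r ?powR_ge0//; exact: (norm_snd_le_enorm (x, t)).
Qed.

End plane_estimates.

(** * The two endpoint estimates *)

Section korn_estimates.
Context {R : realType}.
Local Notation mu := (@lebesgue_measure R).
Local Notation T := (measurableTypeR R).

Lemma Ccinfty_bounded_support (u : R * R -> R * R) : Ccinfty u ->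
  exists M : R, forall x, (M < `|x.1|) || (M < `|x.2|) -> u x = 0.
Proof.
move=> [_ /compact_bounded [M [_ bM]]]; exists (M + 1) => x Mx.
apply: contrapT => /eqP ux0.
have : `|x| <= M + 1.
  by apply: bM; [rewrite ltrDl|exact: subset_closure].
rewrite leNgt => /negP; apply.
by rewrite [`|x|]/Num.norm/= lt_max.
Qed.

Variables (u : R * R -> R * R) (a : R).
Hypothesis hu : Ccinfty u.
Hypothesis a1 : 1 <= a.

Let du i j x : derivable (coord2 i \o u) x (basis2 j).
Proof. exact: ((hu.1 i [::]).2 j x). Qed.

Let cu i : continuous (coord2 i \o u).
Proof. exact: (hu.1 i [::]).1. Qed.

Let cdu i j : continuous (partial j (coord2 i \o u)).
Proof. exact: (hu.1 i [:: j]).1. Qed.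

Let e (z : T * T) : R := enorm z `^ a * mxenorm (Dsym u z).

Let e0 z : 0 <= e z.
Proof. by rewrite mulr_ge0 ?powR_ge0 ?sqrtr_ge0. Qed.

Lemma measurable_weighted_Dsym :
  measurable_fun setT (fun z : T * T => enorm z `^ a * mxenorm (Dsym u z)).
Proof.
apply: measurable_funM; first exact: measurable_enorm_powR.
apply: (measurableT_comp measurable_sqrt).
apply: measurable_sum => i; apply: measurable_sum => j.
rewrite (_ : (fun _ => _) = (fun z : T * T => (2^-1 *
  (partial j (coord2 i \o u) z + partial i (coord2 j \o u) z)) ^+ 2)).
  apply: measurable_funX; apply: measurable_funM => //.
  by apply: measurable_funD; exact: continuous_measurable_fun2.
by apply/funext => z; rewrite !mxE.
Qed.

Let me : measurable_fun setT (fun z : T * T => (e z)%:E).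
Proof. by apply/measurable_EFinP; exact: measurable_weighted_Dsym. Qed.

Lemma measurable_enorm_comp :
  measurable_fun setT (fun z : T * T => enorm (u z)).
Proof.
apply: (measurableT_comp measurable_sqrt).
apply: measurable_funD; apply: measurable_funX.
  exact: (continuous_measurable_fun2 (@cu 0)).
exact: (continuous_measurable_fun2 (@cu 1)).
Qed.

Let mass := (\int[lebesgue2]_z (e z)%:E)%E.

(** The endpoint [q = 1]: the pure derivatives alone suffice. *)
Lemma hardy_Dsym :
  (\int[lebesgue2]_z (enorm z `^ (a - 1) * enorm (u z))%:E <=
   2%:E * \int[lebesgue2]_z (enorm z `^ a * mxenorm (Dsym u z))%:E)%E.
Proof.
have [M uM] := Ccinfty_bounded_support hu.
have uM' i x : (M < `|x.1|) || (M < `|x.2|) -> (coord2 i \o u) x = 0.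
  by move=> /uM ux; rewrite /= ux /coord2; case: ifP.
have H i : (\int[lebesgue2]_z (enorm z `^ a *
    `|partial i (coord2 i \o u) z|)%:E <= mass)%E.
  apply: ge0_le_integral => //.
  - by move=> z _; rewrite lee_fin mulr_ge0 ?powR_ge0.
  - exact: measurable_weighted.
  - move=> z _; rewrite lee_fin ler_wpM2l ?powR_ge0//.
    exact: Dsym_pure_bound.
have m i := measurable_weighted (a - 1) (@cu i).
apply: (@le_trans _ _ (\int[lebesgue2]_z
    ((enorm z `^ (a - 1) * `|(coord2 0 \o u) z|)%:E +
     (enorm z `^ (a - 1) * `|(coord2 1 \o u) z|)%:E))%E).
  apply: ge0_le_integral => //.
  - by move=> z _; rewrite lee_fin mulr_ge0 ?powR_ge0 ?enorm_ge0.
  - apply/measurable_EFinP; apply: measurable_funM.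
      exact: measurable_enorm_powR.
    exact: measurable_enorm_comp.
  - exact: emeasurable_funD.
  - move=> z _; rewrite -EFinD lee_fin -mulrDr ler_wpM2l ?powR_ge0//.
    exact: enorm_le_sum.
have w0 i (z : T * T) :
    (0 <= (enorm z `^ (a - 1) * `|(coord2 i \o u) z|)%:E)%E.
  by rewrite lee_fin mulr_ge0 ?powR_ge0.
rewrite ge0_integralD// -[2]/(1 + 1) EFinD ge0_muleDl ?lee_fin// !mul1e.
apply: leeD.
  apply: le_trans (H 0).
  exact: (hardy_horizontal (@du 0) (@cu 0) (@cdu 0) (uM' 0)).
apply: le_trans (H 1).
exact: (hardy_vertical (@du 1) (@cu 1) (@cdu 1) (uM' 1)).
Qed.

Let e0E z : (0 <= (e z)%:E)%E.
Proof. by rewrite lee_fin. Qed.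

Let a0 : 0 <= a. Proof. by apply: le_trans a1. Qed.

Lemma le_horizontal_mass (x y : R) :
  ((enorm (x, y) `^ a * `|(coord2 0 \o u) (x, y)|)%:E <=
   horizontal_mass (fun z => (e z)%:E) y)%E.
Proof.
have [M uM] := Ccinfty_bounded_support hu.
apply: (@weighted_le_total_integral _ (fun t => (coord2 0 \o u) (t, y)) _
  (fun t => enorm (t, y) `^ a) (fun t => e (t, y)) 0 M
  (is_derive_horizontal (@du 0) y)).
- by apply: continuous_along => // t; [exact: cvg_id|exact: cvg_cst].
- by move=> t Mt; rewrite /= uM// Mt.
- by move=> t; exact: powR_ge0.
- apply: (measurableT_comp (measurable_enorm_powR a)).
  exact: pair2_measurable.
- by move=> s t; exact: enorm_powR_horizontal.
- apply: (measurableT_comp measurable_weighted_Dsym).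
  exact: pair2_measurable.
- move=> t; rewrite ler_wpM2l ?powR_ge0//; exact: Dsym_pure_bound.
Qed.

Lemma le_vertical_mass (x y : R) :
  ((enorm (x, y) `^ a * `|(coord2 1 \o u) (x, y)|)%:E <=
   vertical_mass (fun z => (e z)%:E) x)%E.
Proof.
have [M uM] := Ccinfty_bounded_support hu.
apply: (@weighted_le_total_integral _ (fun t => (coord2 1 \o u) (x, t)) _
  (fun t => enorm (x, t) `^ a) (fun t => e (x, t)) 0 M
  (is_derive_vertical (@du 1) x)).
- by apply: continuous_along => // t; [exact: cvg_cst|exact: cvg_id].
- by move=> t Mt; rewrite /= uM// Mt orbT.
- by move=> t; exact: powR_ge0.
- apply: (measurableT_comp (measurable_enorm_powR a)).
  exact: pair1_measurable.
- by move=> s t; exact: enorm_powR_vertical.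
- apply: (measurableT_comp measurable_weighted_Dsym).
  exact: pair1_measurable.
- move=> t; rewrite ler_wpM2l ?powR_ge0//; exact: Dsym_pure_bound.
Qed.

(** The factor 1/2 compensates for the length of the direction (1, 1), whose
    square bounds the derivative in that direction against [Dsym]. *)
Lemma le_diagonal_mass (x y : R) :
  ((2^-1 * (enorm (x, y) `^ a *
     `|(coord2 0 \o u) (x, y) + (coord2 1 \o u) (x, y)|))%:E <=
   diagonal_mass (fun z => (e z)%:E) (x - y)%R)%E.
Proof.
have [M uM] := Ccinfty_bounded_support hu.
set d := x - y.
have m_diag : measurable_fun setT (fun t : T => ((d + (t : R), t) : T * T)).
  by apply: measurable_fun_pair => //; exact: measurable_funD.
have c_diag : continuous (fun t : R => d + t).
  by move=> t; apply: cvgD; [exact: cvg_cst|exact: cvg_id].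
pose f i t := (coord2 i \o u) (d + t, t).
pose df i t := partial 0 (coord2 i \o u) (d + t, t) +
  partial 1 (coord2 i \o u) (d + t, t).
have cdf i : continuous (df i).
  by move=> t; apply: cvgD; apply: (continuous_along (@cdu _ _) c_diag) => r;
    exact: cvg_id.
have fdf (t : R) : is_derive t (1 : R) (f 0 + f 1) (df 0 t + df 1 t).
  by apply: is_deriveD; exact: is_derive_diagonal.
have := @weighted_le_total_integral _ (f 0 + f 1) (fun t => df 0 t + df 1 t)
  (fun t => enorm (d + t, t) `^ a) (fun t => 2 * e (d + t, t)) (- (d / 2)) M
  fdf.
move=> /(_ _ _ _ _ _ _ _ y) H.
rewrite EFinM lee_pdivrMl// -ge0_integralZl_EFin//; last first.
  exact: (measurableT_comp me).
rewrite (_ : x = d + y); last by rewrite subrK.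
apply: H.
- by move=> t; apply: cvgD; exact: cdf.
- move=> t Mt; suff : f 0 t + f 1 t = 0 by [].
  rewrite /f/= uM/= ?Mt ?orbT//.
  by rewrite /coord2/= addr0.
- by move=> t; exact: powR_ge0.
- exact: (measurableT_comp (measurable_enorm_powR a)).
- by move=> s t; exact: enorm_powR_diagonal.
- apply: measurable_funM => //.
  exact: (measurableT_comp measurable_weighted_Dsym).
- move=> t; rewrite mulrCA ler_wpM2l ?powR_ge0//; exact: Dsym_diagonal_bound.
Qed.

(** The endpoint [q = 2]. With [p] and [q] the components of [u],
    [p ^+ 2 = p * (p + q) - p * q], and similarly for [q ^+ 2], so the square of
    the norm is controlled by products of directional components along two
    different directions, and these are bounded by the products of masses. *)
Lemma korn_sobolev_Dsym :
  (\int[lebesgue2]_z ((enorm z `^ a * enorm (u z)) ^+ 2)%:E <=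
   6%:E * (\int[lebesgue2]_z (enorm z `^ a * mxenorm (Dsym u z))%:E *
           \int[lebesgue2]_z (enorm z `^ a * mxenorm (Dsym u z))%:E))%E.
Proof.
pose K := mass_products (fun z => (e z)%:E).
have K0 z : (0 <= K z)%E by exact: mass_products_ge0.
have mK : measurable_fun setT K by exact: measurable_mass_products.
(* The constant 2 undoes the factor 1/2 of the diagonal bound, and it is the
   multiplicity of the mixed product [p * q]; then 6 = 2 * 3. *)
apply: (@le_trans _ _ (\int[lebesgue2]_z (2%:E * K z))%E); last first.
  rewrite ge0_integralZl_EFin// integral_mass_products//.
  by rewrite muleA -EFinM -natrM.
apply: ge0_le_integral => //.
- by move=> z _; rewrite lee_fin sqr_ge0.
- apply/measurable_EFinP; apply: measurable_funX; apply: measurable_funM.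
    exact: measurable_enorm_powR.
  exact: measurable_enorm_comp.
- by apply: measurable_funeM.
move=> [x y] _.
have := le_horizontal_mass x y; have := le_vertical_mass x y.
have := le_diagonal_mass x y.
set w := enorm (x, y) `^ a; set p := (coord2 0 \o u) (x, y).
set q := (coord2 1 \o u) (x, y).
have w0 : 0 <= w by exact: powR_ge0.
move=> Hd Hv Hh.
apply: (@le_trans _ _ (2%:E * ((w * `|p|)%:E * (2^-1 * (w * `|p + q|))%:E +
   (w * `|q|)%:E * (2^-1 * (w * `|p + q|))%:E +
   (w * `|q|)%:E * (w * `|p|)%:E))%E); last first.
  apply: lee_wpmul2l; first by rewrite lee_fin.
  have P0 : (0 <= (w * `|p|)%:E)%E by rewrite lee_fin mulr_ge0.
  have Q0 : (0 <= (w * `|q|)%:E)%E by rewrite lee_fin mulr_ge0.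
  have S0 : (0 <= (2^-1 * (w * `|p + q|))%:E)%E by rewrite lee_fin !mulr_ge0.
  apply: leeD; first apply: leeD.
  - exact: (lee_pmul P0 S0 Hh Hd).
  - exact: (lee_pmul Q0 S0 Hv Hd).
  - exact: (lee_pmul Q0 P0 Hv Hh).
rewrite -!EFinM lee_fin exprMn enorm_sqr.
rewrite [X in _ <= X](_ : _ = w ^+ 2 * (`|p| * `|p + q| + `|q| * `|p + q| +
  2 * (`|p| * `|q|))); last by field.
rewrite ler_wpM2l ?sqr_ge0// -!normrM.
rewrite (_ : (u (x, y)).1 = p)// (_ : (u (x, y)).2 = q)//.
have := ler_norm (p * (p + q)); have := ler_norm (q * (p + q)).
have := ler_norm (- (p * q)); rewrite normrN !expr2; lra.
Qed.

End korn_estimates.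

(** * Conclusion *)

Theorem theorem1p2 (R : realType) (q a b : R)
    (hq1 : 1 <= q) (hq2 : q <= 2) (ha1 : 1 <= a) (ha2 : a < 2)
    (hqab : (2 + b) / q = 1 + a) :
  exists C : R, 0 < C /\
    forall u : R * R -> R * R, Ccinfty u ->
      ((\int[lebesgue2]_x (enorm x `^ b * enorm (u x) `^ q)%:E) `^ (1 / q)
       <= C%:E * \int[lebesgue2]_x (enorm x `^ a * mxenorm (Dsym u x))%:E)%E.
Proof.
(* 8 = 2 + 6, from the two endpoint estimates. *)
exists 8; split=> [//|u hu].
have q0 : 0 < q by lra.
set I := (\int[lebesgue2]_x (enorm x `^ a * mxenorm (Dsym u x))%:E)%E.
set J := (\int[lebesgue2]_x (enorm x `^ b * enorm (u x) `^ q)%:E)%E.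
have I0 : (0 <= I)%E.
  by apply: integral_ge0 => z _; rewrite lee_fin mulr_ge0 ?powR_ge0 ?sqrtr_ge0.
have J0 : (0 <= J)%E.
  by apply: integral_ge0 => z _; rewrite lee_fin mulr_ge0 ?powR_ge0.
have H1 := hardy_Dsym hu ha1; have H2 := korn_sobolev_Dsym hu ha1.
rewrite -/I in H1 H2.
have mu_ : measurable_fun setT
    (fun z : measurableTypeR R * measurableTypeR R => enorm (u z)).
  exact: measurable_enorm_comp.
(* Interpolating with any [l] above [I] instead of [I] itself covers [I = 0]
   without a separate discussion of functions vanishing almost everywhere. *)
have JI (l : R) : 0 < l -> (I <= l%:E)%E -> (J <= (8 * l `^ q)%:E)%E.
  move=> l0 Il.
  pose A (z : measurableTypeR R * measurableTypeR R) :=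
    (enorm z `^ (a - 1) * enorm (u z))%:E.
  pose B (z : measurableTypeR R * measurableTypeR R) :=
    ((enorm z `^ a * enorm (u z)) ^+ 2)%:E.
  have A0 z : (0 <= A z)%E by rewrite lee_fin mulr_ge0 ?powR_ge0 ?enorm_ge0.
  have B0 z : (0 <= B z)%E by rewrite lee_fin sqr_ge0.
  have mA : measurable_fun setT A.
    apply/measurable_EFinP; apply: measurable_funM => //.
    exact: measurable_enorm_powR.
  have mB : measurable_fun setT B.
    apply/measurable_EFinP; apply: measurable_funX.
    apply: measurable_funM => //.
    exact: measurable_enorm_powR.
  have li0 : 0 <= l^-1 by rewrite invr_ge0 ltW.
  apply: (@le_trans _ _ (\int[lebesgue2]_z
      ((l `^ q)%:E * ((l^-1)%:E * A z + (l^-1 ^+ 2)%:E * B z)))%E).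
    apply: ge0_le_integral => //.
    - by move=> z _; rewrite lee_fin mulr_ge0 ?powR_ge0.
    - apply/measurable_EFinP; apply: measurable_funM.
        exact: measurable_enorm_powR.
      exact: (measurableT_comp (measurable_powR q)).
    - apply: measurable_funeM; apply: emeasurable_funD; exact: measurable_funeM.
    - move=> z _; rewrite -!EFinM lee_fin.
      by apply: powR_interpolation => //; exact: enorm_ge0.
  rewrite ge0_integralZl_EFin ?powR_ge0//; last 2 first.
    by move=> z _; rewrite adde_ge0// mule_ge0// lee_fin ?sqr_ge0.
    by apply: emeasurable_funD; exact: measurable_funeM.
  rewrite (_ : (8 * l `^ q)%:E = ((l `^ q)%:E * 8%:E)%E); last first.
    by rewrite -EFinM mulrC.
  apply: lee_wpmul2l; first by rewrite lee_fin powR_ge0.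
  rewrite ge0_integralD//; last 4 first.
    by move=> z _; rewrite mule_ge0// lee_fin.
    exact: measurable_funeM.
    by move=> z _; rewrite mule_ge0// lee_fin sqr_ge0.
    exact: measurable_funeM.
  rewrite ge0_integralZl_EFin// ge0_integralZl_EFin ?sqr_ge0//.
  have -> : 8 = l^-1 * (2 * l) + l^-1 ^+ 2 * (6 * (l * l)) by field; lra.
  rewrite EFinD [X in (_ <= X + _)%E]EFinM [X in (_ <= _ + X)%E]EFinM.
  apply: leeD; apply: lee_wpmul2l; rewrite ?lee_fin ?sqr_ge0//.
    apply: (le_trans H1); rewrite EFinM lee_wpmul2l ?lee_fin//.
  apply: (le_trans H2); rewrite EFinM lee_wpmul2l ?lee_fin// EFinM.
  exact: lee_pmul.
have [Ioo|Ioo] := eqVneq I +oo%E.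
  by rewrite Ioo gt0_muley ?lte_fin// leey.
have If : I \is a fin_num by rewrite ge0_fin_numE// ltey.
apply/lee_addgt0Pr => eps eps0.
pose l := fine I + eps / 8.
have fI0 : 0 <= fine I by exact: fine_ge0.
have l0 : 0 < l by rewrite /l; lra.
have Il : (I <= l%:E)%E by rewrite -[leLHS]fineK// lee_fin /l; lra.
have -> : (8%:E * I + eps%:E)%E = (8 * l)%:E.
  by rewrite -[in LHS](fineK If) -EFinM -EFinD; congr EFin; rewrite /l; lra.
apply: (@le_trans _ _ ((8 * l `^ q)%:E `^ (1 / q))%E).
  have q10 : 0 <= 1 / q by rewrite div1r invr_ge0 ltW.
  apply: (gt0_ler_poweR q10); last exact: JI.
    by rewrite in_itv/= J0 leey.
  by rewrite in_itv/= leey lee_fin mulr_ge0 ?powR_ge0.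
rewrite poweR_EFin lee_fin powRM ?powR_ge0// -powRrM div1r mulfV ?gt_eqF//.
rewrite powRr1 ?(ltW l0)// ler_wpM2r ?(ltW l0)//.
rewrite -[leRHS]powRr1//; apply: ler_powR; first by lra.
by rewrite invf_le1.
Qed.
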